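(* For any $n\in\mathbb{Z}$ and $q\in(0,1)$, $$\sum_{k=\max\{-n,0\}}^\infty\frac{q^{(k+1)(n+k)}}{(q;q)_k(q;q)_{n+k}}+\sum_{k=\max\{1-n,0\}}^\infty\frac{q^{k(n+k)}}{(q;q)_k(q;q)_{n-1+k}}=\frac{1}{(q;q)_\infty}.$$
   Context: $(q;q)_0=1$, $(q;q)_r=\prod_{i=1}^{r}(1-q^i)$ for $r\ge1$, and $(q;q)_\infty=\prod_{i=1}^\infty(1-q^i)$. *)

(* Defs.v *)
From mathcomp Require Import all_boot all_order all_algebra.
From mathcomp Require Import all_classical all_reals all_analysis.

Set Implicit Arguments.
Unset Strict Implicit.
Unset Printing Implicit Defensive.

Import Order.TTheory GRing.Theory Num.Theory.
Import numFieldNormedType.Exports.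

Local Open Scope classical_set_scope.
Local Open Scope ring_scope.

Definition qpoch (R : realType) (q : R) (r : nat) : R :=
  \prod_(1 <= i < r.+1) (1 - q ^+ i).

Definition qpoch_inf (R : realType) (q : R) : R := limn (qpoch q).

(* [limn] returns a default value on divergent sequences; for q in (0, 1) the
   infinite product is a genuine limit. *)
Lemma qpoch_cvgn (R : realType) (q : R) : 0 < q < 1 -> cvgn (qpoch q).
Proof.
move=> /andP[q0 q1].
have fac i : 0 <= 1 - q ^+ i <= 1.
  have q0' := ltW q0; have q1' := ltW q1.
  by rewrite subr_ge0 exprn_ile1 //= lerBlDr lerDl exprn_ge0.
have qp0 r : 0 <= qpoch q r.
  by apply: prodr_ge0 => i _; have /andP[] := fac i.
apply: nonincreasing_is_cvgn.
  apply/nonincreasing_seqP => r.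
  rewrite /qpoch [leLHS]big_nat_recr //=.
  by apply: ler_piMr; [exact: qp0 | have /andP[] := fac r.+1].
by exists 0 => _ [r _ <-].
Qed.

(* Main.v *)
Require Import Defs.
From mathcomp Require Import all_boot all_order all_algebra.
From mathcomp Require Import all_classical all_reals all_analysis.
From mathcomp Require Import zify ring lra.

Import Order.TTheory GRing.Theory Num.Theory.
Import numFieldNormedType.Exports.

Local Open Scope classical_set_scope.
Local Open Scope ring_scope.

Set Implicit Arguments.
Unset Strict Implicit.
Unset Printing Implicit Defensive.

(* With D_m = sum_k q^(k(k+m)) / ((q;q)_k (q;q)_(k+m)), write A and B for the
   two sums of the statement at n = m+1.  Splitting 1 = q^k + (1 - q^k) in the
   terms of D_m gives D_m = B + A, and splitting 1 = q^(k+m+1) + (1 - q^(k+m+1))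
   in the terms of D_(m+1) gives D_(m+1) = A + B.  So D_m does not depend on m,
   and as m tends to infinity only its term k = 0, which is 1/(q;q)_m, survives.
   The remaining values n = -m follow because shifting the summation index
   exchanges the two sums under n -> 1 - n. *)

(** Generating function of the partitions whose Durfee rectangle is k by k + m. *)
Definition durfee_term (R : realType) (q : R) (m k : nat) : R :=
  q ^+ (k * (k + m)) / (qpoch q k * qpoch q (k + m)).

Definition left_term (R : realType) (q : R) (m k : nat) : R :=
  q ^+ (k.+1 * (k + m.+1)) / (qpoch q k * qpoch q (k + m.+1)).

Definition right_term (R : realType) (q : R) (m k : nat) : R :=
  q ^+ (k * (k + m.+1)) / (qpoch q k * qpoch q (k + m)).

Lemma qpochS (R : realType) (q : R) (r : nat) :
  qpoch q r.+1 = qpoch q r * (1 - q ^+ r.+1).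
Proof. by rewrite /qpoch big_nat_recr. Qed.

Lemma qpoch_gt0 (R : realType) (q : R) (hq : 0 < q < 1) (r : nat) :
  0 < qpoch q r.
Proof.
case/andP: hq => q0 q1; elim: r => [|r IH].
  by rewrite /qpoch big_nil.
by rewrite qpochS mulr_gt0 // subr_gt0 exprn_ilt1 // ltW.
Qed.

Lemma geometric_partial_le (R : realType) (q : R) (hq : 0 < q < 1) (r : nat) :
  \sum_(0 <= i < r) q ^+ i <= (1 - q)^-1.
Proof.
case/andP: hq => q0 q1.
have d0 : 0 < 1 - q by lra.
rewrite -[leRHS]mul1r ler_pdivlMr //.
have -> : (\sum_(0 <= i < r) q ^+ i) * (1 - q) = 1 - q ^+ r.
  by rewrite big_mkord mulrC -[in RHS](expr1n R r) subrXX; congr (_ * _);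
    apply: eq_bigr => i _; rewrite expr1n mul1r.
by rewrite gerBl exprn_ge0 // ltW.
Qed.

(* [1 - x = (1 + x / (1 - x))^-1], so [expR] dominates the denominator. *)
Lemma expRN_le_1B (R : realType) (x : R) :
  x < 1 -> expR (- (x / (1 - x))) <= 1 - x.
Proof.
move=> x1; have d0 : 0 < 1 - x by lra.
rewrite expRN invf_ple ?posrE ?expR_gt0 //.
apply: le_trans (expR_ge1Dx _).
by rewrite le_eqVlt; apply/orP; left; apply/eqP; field; lra.
Qed.

(** Bounding each factor below by [expRN_le_1B], then using 1 - q^i >= 1 - q and q^i <= q^(i-1),
    leaves a geometric series in the exponent. Uniformity in [r] makes the infinite product positive
    and the denominators harmless. *)
Lemma qpoch_ge (R : realType) (q : R) (hq : 0 < q < 1) (r : nat) :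
  expR (- (1 - q)^-1 ^+ 2) <= qpoch q r.
Proof.
case/andP: (hq) => q0 q1; have d0 : 0 < 1 - q by lra.
(* The induction needs the partial geometric sum; the constant bound would not survive an extra
   factor. *)
have bnd : expR (- ((\sum_(0 <= i < r) q ^+ i) / (1 - q))) <= qpoch q r.
  elim: r => [|r IH]; first by rewrite /qpoch !big_nil mul0r oppr0 expR0.
  rewrite qpochS big_nat_recr //= mulrDl opprD expRD.
  apply: ler_pM => //; try exact: expR_ge0.
  have qr1 : q ^+ r.+1 <= q by rewrite exprS ger_pMr // exprn_ile1 // ltW.
  apply: le_trans (expRN_le_1B _); last by lra.
  rewrite ler_expR lerN2.
  apply: ler_pM; rewrite ?exprn_ge0 ?invr_ge0 ?(ltW q0) //; try lra.
    by rewrite exprS ger_pMl ?exprn_gt0 // ltW.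
  by rewrite lef_pV2 ?posrE //; lra.
apply: le_trans bnd; rewrite ler_expR lerN2 expr2.
by rewrite ler_pM2r ?invr_gt0 // geometric_partial_le.
Qed.

Lemma qpoch_inf_gt0 (R : realType) (q : R) (hq : 0 < q < 1) : 0 < qpoch_inf q.
Proof.
apply: lt_le_trans (expR_gt0 (- (1 - q)^-1 ^+ 2)) _.
apply: limr_ge; first exact: qpoch_cvgn.
by apply: nearW => r; exact: qpoch_ge.
Qed.

Lemma qpoch_ratio_ge0 (R : realType) (q : R) (hq : 0 < q < 1) (e i j : nat) :
  0 <= q ^+ e / (qpoch q i * qpoch q j).
Proof.
case/andP: (hq) => q0 _.
by rewrite divr_ge0 ?exprn_ge0 ?mulr_ge0 // ltW // qpoch_gt0.
Qed.

(** The constant is independent of [i] and [j], so this gives both convergence of all the series and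
    the tail estimate as m grows. *)
Lemma qpoch_ratio_le (R : realType) (q : R) (hq : 0 < q < 1) (k e i j : nat) :
  (k <= e)%N ->
  q ^+ e / (qpoch q i * qpoch q j) <= expR (- (1 - q)^-1 ^+ 2) ^- 2 * q ^+ k.
Proof.
case/andP: (hq) => q0 q1 ke; rewrite mulrC.
apply: ler_pM.
- by rewrite invr_ge0 mulr_ge0 // ltW // qpoch_gt0.
- by rewrite exprn_ge0 // ltW.
- rewrite lef_pV2 ?posrE ?mulr_gt0 ?exprn_gt0 ?expR_gt0 ?qpoch_gt0 // expr2.
  by rewrite ler_pM ?expR_ge0 ?qpoch_ge.
- by apply: ler_wiXn2l => //; exact: ltW.
Qed.

Lemma is_cvg_qpoch_ratio_series (R : realType) (q : R) (hq : 0 < q < 1)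
    (e i j : nat -> nat) : (forall k, k <= e k)%N ->
  cvgn (series (fun k => q ^+ e k / (qpoch q (i k) * qpoch q (j k)))).
Proof.
case/andP: (hq) => q0 q1 ke.
apply: (@series_le_cvg _ _ (geometric (expR (- (1 - q)^-1 ^+ 2) ^- 2) q)).
- by move=> k; exact: qpoch_ratio_ge0.
- by move=> k /=; rewrite mulr_ge0 ?invr_ge0 ?exprn_ge0 ?expR_ge0 // ltW.
- by move=> k /=; exact: qpoch_ratio_le.
- by apply: is_cvg_geometric_series; rewrite ger0_norm // ltW.
Qed.

Lemma is_cvg_durfee (R : realType) (q : R) (hq : 0 < q < 1) (m : nat) :
  cvgn (series (durfee_term q m)).
Proof. by apply: is_cvg_qpoch_ratio_series => // k; nia. Qed.

Lemma is_cvg_left (R : realType) (q : R) (hq : 0 < q < 1) (m : nat) :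
  cvgn (series (left_term q m)).
Proof. by apply: is_cvg_qpoch_ratio_series => // k; nia. Qed.

Lemma is_cvg_right (R : realType) (q : R) (hq : 0 < q < 1) (m : nat) :
  cvgn (series (right_term q m)).
Proof. by apply: is_cvg_qpoch_ratio_series => // k; nia. Qed.

(** Split 1 = q^(k+1) + (1 - q^(k+1)): the second part cancels the last factor of [qpoch q k.+1],
    which lowers the index of [left_term] to [k]. *)
Lemma durfee_termE (R : realType) (q : R) (hq : 0 < q < 1) (m k : nat) :
  durfee_term q m k.+1 = right_term q m k.+1 + left_term q m k.
Proof.
have Q0 := qpoch_gt0 hq; have Qk := Q0 k; have Qkm := Q0 (k + m.+1)%N.
have := Q0 k.+1; rewrite /durfee_term /right_term /left_term qpochS.
rewrite (pmulr_rgt0 _ Qk) => d0.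
have -> : (k.+1 + m = k + m.+1)%N by lia.
have -> : (k.+1 * (k.+1 + m.+1) = k.+1 * (k + m.+1) + k.+1)%N by lia.
rewrite exprD; set x := q ^+ (_ * _); set y := q ^+ _ in d0 *.
by field; rewrite !gt_eqF.
Qed.

(** Here 1 = q^(k+m+1) + (1 - q^(k+m+1)) cancels in the other denominator, so no index moves. *)
Lemma durfee_termSE (R : realType) (q : R) (hq : 0 < q < 1) (m k : nat) :
  durfee_term q m.+1 k = left_term q m k + right_term q m k.
Proof.
have Q0 := qpoch_gt0 hq; have Qk := Q0 k; have Qkm := Q0 (k + m)%N.
have := Q0 (k + m).+1; rewrite /durfee_term /right_term /left_term.
rewrite !addnS qpochS (pmulr_rgt0 _ Qkm) => d0.
have -> : (k.+1 * (k + m).+1 = k * (k + m).+1 + (k + m).+1)%N by lia.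
rewrite exprD; set x := q ^+ (_ * _); set y := q ^+ _ in d0 *.
by field; rewrite !gt_eqF.
Qed.

(** The left sum is one term shorter: at k = 0 the factor 1 - q^k vanishes, so that term comes from
    [right_term] alone. *)
Lemma durfee_partial (R : realType) (q : R) (hq : 0 < q < 1) (m N : nat) :
  series (durfee_term q m) N.+1 =
  series (left_term q m) N + series (right_term q m) N.+1.
Proof.
elim: N => [|N IH].
  rewrite /series /= !big_nat1 big_nil add0r /durfee_term /right_term.
  by rewrite !mul0n.
rewrite /series /= in IH *; rewrite big_nat_recr //= IH durfee_termE //.
by rewrite [in RHS]big_nat_recr //= (big_nat_recr N.+1) //=; ring.
Qed.

Lemma durfeeE (R : realType) (q : R) (hq : 0 < q < 1) (m : nat) :
  limn (series (durfee_term q m)) =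
  limn (series (left_term q m)) + limn (series (right_term q m)).
Proof.
apply: cvg_lim => //; rewrite -cvg_shiftS.
under eq_fun do rewrite durfee_partial //.
apply: cvgD; first exact: is_cvg_left.
by rewrite (cvg_shiftS (series (right_term q m))); exact: is_cvg_right.
Qed.

Lemma durfeeSE (R : realType) (q : R) (hq : 0 < q < 1) (m : nat) :
  limn (series (durfee_term q m.+1)) = limn (series (durfee_term q m)).
Proof.
rewrite [RHS]durfeeE //; apply: cvg_lim => //.
have -> : series (durfee_term q m.+1) =
    series (left_term q m) \+ series (right_term q m).
  apply/funext => N; rewrite /series /= -big_split /=.
  by apply: eq_bigr => k _; exact: durfee_termSE.
by apply: cvgD; [exact: is_cvg_left | exact: is_cvg_right].
Qed.

Lemma durfee_partial_bounds (R : realType) (q : R) (hq : 0 < q < 1) (m N : nat) :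
  (qpoch q m)^-1 <= series (durfee_term q m) N.+1 <=
  (qpoch q m)^-1 + expR (- (1 - q)^-1 ^+ 2) ^- 2 * (1 - q)^-1 * q ^+ m.
Proof.
case/andP: (hq) => q0 q1.
have t0 : durfee_term q m 0 = (qpoch q m)^-1.
  by rewrite /durfee_term mul0n expr0 add0n /qpoch big_nil !mul1r.
rewrite /series /= big_nat_recl //= t0 lerDl lerD2l; apply/andP; split.
  by apply: sumr_ge0 => k _; exact: qpoch_ratio_ge0.
set c := _ ^- 2; apply: (@le_trans _ _ (c * q ^+ m * \sum_(0 <= k < N) q ^+ k)).
  rewrite mulr_sumr; apply: ler_sum => k _; rewrite -mulrA -exprD.
  (* The exponent (k+1)(k+1+m) is at least m + k, whence the factor q^m. *)
  by apply: qpoch_ratio_le => //; nia.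
rewrite [leRHS]mulrAC ler_wpM2l ?geometric_partial_le //.
by rewrite mulr_ge0 ?invr_ge0 ?exprn_ge0 ?expR_ge0 // ltW.
Qed.

Lemma durfee_sum (R : realType) (q : R) (hq : 0 < q < 1) (m : nat) :
  limn (series (durfee_term q m)) = (qpoch_inf q)^-1.
Proof.
set D := LHS.
(* Since the sum does not depend on its parameter, the bounds for every [p] constrain the single
   number [D]. *)
have Dm p : limn (series (durfee_term q p)) = D.
  suff D0 r : limn (series (durfee_term q r)) = limn (series (durfee_term q 0)).
    by rewrite /D !D0.
  by elim: r => // r IH; rewrite durfeeSE.
case/andP: (hq) => q0 q1.
set C := expR (- (1 - q)^-1 ^+ 2) ^- 2 * (1 - q)^-1.
have Qinv : (qpoch q p)^-1 @[p --> \oo] --> (qpoch_inf q)^-1.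
  by apply: cvgV; [rewrite gt_eqF // qpoch_inf_gt0 | exact: qpoch_cvgn].
have bnd p : (qpoch q p)^-1 <= D <= (qpoch q p)^-1 + C * q ^+ p.
  have cD : cvgn (series (durfee_term q p)) by exact: is_cvg_durfee.
  rewrite -(Dm p); apply/andP; split; [apply: limr_ge|apply: limr_le] => //.
    (* Rank 0 is excluded: the empty partial sum lies below the lower bound. *)
    by exists 1%N => // -[//|N] _; have /andP[] := durfee_partial_bounds hq p N.
  by exists 1%N => // -[//|N] _; have /andP[] := durfee_partial_bounds hq p N.
suff Dl : (fun=> D) @ \oo --> (qpoch_inf q)^-1.
  by rewrite -(cvg_lim _ Dl) // lim_cst.
apply: (squeeze_cvgr _ Qinv); first by apply: nearW => p; exact: bnd.
rewrite -[X in _ --> X]addr0 -(mulr0 C); apply: cvgD => //.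
by apply: cvgMl_tmp; apply: cvg_expr; rewrite ger0_norm // ltW.
Qed.

Lemma left_right_sum (R : realType) (q : R) (hq : 0 < q < 1) (m : nat) :
  limn (series (left_term q m)) + limn (series (right_term q m)) =
  (qpoch_inf q)^-1.
Proof. by rewrite -durfeeE // durfee_sum. Qed.

(** Transfers limits of series indexed from 0 to the sums of the theorem, whose starting index
    depends on n. *)
Lemma cvg_sum_shift (R : realType) (u v : R ^nat) (m : nat) (l : R) :
  series v @ \oo --> l -> (forall k, u (k + m)%N = v k) ->
  (fun N => \sum_(m <= k < N) u k) @ \oo --> l.
Proof.
move=> vl uv; rewrite -(cvg_shiftn m).
rewrite (_ : [sequence _]_n = series v) //; apply/funext => N /=.
rewrite -[X in \sum_(X <= _ < _) _](add0n m) big_addn addnK.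
by apply: eq_bigr => k _; rewrite uv.
Qed.

(* On both ranges of summation the exponents and the integers n + k and
   n - 1 + k are nonnegative, so [absz] only casts to nat. *)
Theorem proposition1p11 (R : realType) (n : int) (q : R) (hq : 0 < q < 1) :
  let a := fun k : nat =>
    q ^ ((k%:Z + 1) * (n + k%:Z)) / (qpoch q k * qpoch q (absz (n + k%:Z))) in
  let b := fun k : nat =>
    q ^ (k%:Z * (n + k%:Z)) / (qpoch q k * qpoch q (absz (n - 1 + k%:Z))) in
  let ka := absz (Num.max (- n) 0) in
  let kb := absz (Num.max (1 - n) 0) in
  [/\ cvgn (fun N : nat => \sum_(ka <= k < N) a k),
      cvgn (fun N : nat => \sum_(kb <= k < N) b k) &
      \big[+%R/0]_(ka <= k <oo) a k + \big[+%R/0]_(kb <= k <oo) b k = (qpoch_inf q)^-1].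
Proof.
move=> a b ka kb.
suff [A [B [al bl AB]]] : exists A B : R, [/\
    (fun N => \sum_(ka <= k < N) a k) @ \oo --> A,
    (fun N => \sum_(kb <= k < N) b k) @ \oo --> B & A + B = (qpoch_inf q)^-1].
  split; [by apply/cvg_ex; exists A | by apply/cvg_ex; exists B |].
  by rewrite -AB; congr (_ + _); exact: cvg_lim.
case: (ltP 0 n) => n0.
  have [m nE] : exists m : nat, n = m.+1%:Z by exists `|n - 1|%N; lia.
  have -> : ka = 0%N by rewrite /ka; lia.
  have -> : kb = 0%N by rewrite /kb; lia.
  exists (limn (series (left_term q m))), (limn (series (right_term q m))).
  split; last exact: left_right_sum.
    apply: (cvg_sum_shift (is_cvg_left (m := m) hq)) => k; rewrite /a /left_term addn0 nE.
    have -> : (k%:Z + 1) * (m.+1%:Z + k%:Z) = (k.+1 * (k + m.+1))%N%:Z by lia.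
    by have -> : absz (m.+1%:Z + k%:Z) = (k + m.+1)%N by lia.
  apply: (cvg_sum_shift (is_cvg_right (m := m) hq)) => k; rewrite /b /right_term addn0 nE.
  have -> : k%:Z * (m.+1%:Z + k%:Z) = (k * (k + m.+1))%N%:Z by lia.
  by have -> : absz (m.+1%:Z - 1 + k%:Z) = (k + m)%N by lia.
(* For n = -m the sums start at m and m + 1. Reindexed from 0, they become the right and left series
   respectively, with the two denominator factors swapped. *)
have [m nE] : exists m : nat, n = - m%:Z by exists `|n|%N; lia.
have -> : ka = m by rewrite /ka; lia.
have -> : kb = m.+1 by rewrite /kb; lia.
exists (limn (series (right_term q m))), (limn (series (left_term q m))).
split; last by rewrite addrC; exact: left_right_sum.
  apply: (cvg_sum_shift (is_cvg_right (m := m) hq)) => k; rewrite /a /right_term nE.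
  have -> : ((k + m)%N%:Z + 1) * (- m%:Z + (k + m)%N%:Z) = (k * (k + m.+1))%N%:Z.
    by lia.
  have -> : absz (- m%:Z + (k + m)%N%:Z) = k by lia.
  by rewrite [X in _ / X]mulrC.
apply: (cvg_sum_shift (is_cvg_left (m := m) hq)) => k; rewrite /b /left_term nE.
have -> : (k + m.+1)%N%:Z * (- m%:Z + (k + m.+1)%N%:Z) = (k.+1 * (k + m.+1))%N%:Z.
  by lia.
have -> : absz (- m%:Z - 1 + (k + m.+1)%N%:Z) = k by lia.
by rewrite [X in _ / X]mulrC.
Qed.
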